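(* If $n\ge1$ and $d\ge0$, then $$c(n,2d,0)=\begin{cases}2\dbinom{\frac{n+d}{2}-1}{2d-1}, & \text{if } n\equiv d\pmod 2,\\[2mm] 0, & \text{otherwise,}\end{cases}$$ and $$c(n,2d+1,0)=\begin{cases}\dbinom{\frac{n+d}{2}-1}{2d}, & \text{if } n\equiv d\pmod 2,\\[2mm] \dbinom{\frac{n+d-1}{2}}{2d}, & \text{otherwise.}\end{cases}$$
   Context: A composition of a positive integer $n$ with $k$ parts is a sequence $\sigma_1\sigma_2\cdots\sigma_k$ of positive integers with $\sigma_1+\cdots+\sigma_k=n$ (so there is no composition of $n\ge1$ with $0$ parts). A parity succession is an index $i$ with $1\le i\le k-1$ and $\sigma_{i+1}\equiv\sigma_i\pmod2$. The number $c(n,k,0)$ is the number of compositions of $n$ with exactly $k$ parts containing no parity successions, i.e. whose parts alternate between even and odd values. Binomial coefficients $\binom{u}{v}$ with integer $u\ge0$ are $0$ when $v<0$ or $v>u$. *)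

(* Defs.v *)
From mathcomp Require Import all_boot all_order all_algebra.
Set Implicit Arguments.
Unset Strict Implicit.
Unset Printing Implicit Defensive.

Definition is_composition (n : nat) (s : seq nat) : bool :=
  all (fun x => 0 < x) s && (sumn s == n).

(* Positions are 0-based: i ranges over 0 <= i < k - 1, where k is the number
   of parts. *)
Definition parity_successions (s : seq nat) : nat :=
  \sum_(i < (size s).-1) (nth 0 s i.+1 == nth 0 s i %[mod 2]).

(* The number of compositions of n with exactly k parts and exactly r parity
   successions.  Every part of a composition of n is at most n, so taking the
   parts in 'I_n.+1 loses no composition and makes the set finite. *)
Definition c (n k r : nat) : nat :=
  #|[set t : k.-tuple 'I_n.+1 |
      is_composition n (map val t) && (parity_successions (map val t) == r)]|.

(* 'C(u, v) extended by 0 to negative v; truncated subtraction in the lower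
   index would turn the value 0 at v = -1 into 'C(u, 0) = 1. *)
Definition binz (u : nat) (v : int) : nat :=
  if v is Posz m then 'C(u, m) else 0.

(* Main.v *)
Require Import Defs.
From mathcomp Require Import all_boot all_order all_algebra.
From mathcomp Require Import zify.

(* Halving the parts, rounding up, turns an alternating composition of n whose
   first part has a given parity into an arbitrary composition of (n + o) / 2
   with as many parts, where o is the number of odd parts, and this is a
   bijection; compositions of m with k parts number 'C(m - 1, k - 1).  The
   count is carried out by a Pascal recursion: either the first part exceeds 2
   and can be decreased by 2, or it is the least part of its parity and can be
   removed. *)

Definition parity_differs : rel nat := fun x y => odd x != odd y.

Fixpoint alternating (b : bool) (k n : nat) : seq (seq nat) :=
  if k is k'.+1 then
    [seq x :: s | x <- [seq x <- iota 1 n | odd x == b],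
                  s <- alternating (~~ b) k' (n - x)]
  else if n == 0 then [:: [::]] else [::].

Lemma eq_path_parity_differs x y s :
  odd x = odd y -> path parity_differs x s = path parity_differs y s.
Proof. by case: s => //= z s xy; rewrite /parity_differs xy. Qed.

(* The parity of the first part is enforced by prepending a part, possibly 0,
   of the other parity. *)
Lemma mem_alternating b k n s :
  (s \in alternating b k n) =
    [&& size s == k, is_composition n s & path parity_differs (~~ b) s].
Proof.
elim: k b n s => [|k IHk] b n s /=.
  by case: s => [|x s]; case: n.
apply/allpairsPdep/idP => [[x [t [xs ts ->]]]|].
  move: xs ts; rewrite mem_filter mem_iota IHk => /and3P[/eqP <- x0 xn].
  case/and3P=> szt /andP[t0 /eqP sumt] pt.
  rewrite /is_composition /= eqSS szt x0 t0 sumt subnKC //= eqxx.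
  rewrite {1}/parity_differs oddb (@eq_path_parity_differs _ (~~ ~~ odd x)) ?pt.
    by case: (odd x).
  by case: (odd x).
case: s => [|x s] //=; rewrite eqSS => /and3P[szs].
rewrite /is_composition /= => /andP[/andP[x0 s0] /eqP sums] /andP[bx ps].
exists x, s; split=> //.
  by rewrite mem_filter mem_iota; move: bx; rewrite /parity_differs; lia.
rewrite IHk szs /is_composition s0 -sums addKn eqxx /=.
have {bx} <- : odd x = b by move: bx; rewrite /parity_differs; lia.
by rewrite (@eq_path_parity_differs _ x) // oddb negbK.
Qed.

Lemma alternating_uniq b k n : uniq (alternating b k n).
Proof.
elim: k b n => [|k IHk] b n /=; first by case: ifP.
apply: allpairs_uniq_dep => [|x _|]; first by rewrite filter_uniq // iota_uniq.
- exact: IHk.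
- by move=> [x s] [y t] _ _ /= [-> ->].
Qed.

Lemma size_alternating0 b k : size (alternating b k.+1 0) = 0.
Proof. by []. Qed.

Lemma size_alternating1 b k :
  size (alternating b k.+1 1) = if b then size (alternating false k 0) else 0.
Proof. by case: b; rewrite //= cats0 size_map. Qed.

(** The least part of parity [b] is 1 or 2, and removing it from a composition of [n.+2] leaves
    [n + b]; the second summand lowers a larger first part by 2. *)
Lemma size_alternatingSS b k n :
  size (alternating b k.+1 n.+2) =
    size (alternating (~~ b) k (n + b)) + size (alternating b k.+1 n).
Proof.
(* The candidates for the first part are 1, 2 and the shift of [iota 1 n] by 2, which preserves the
   parity filter. *)
rewrite /= !size_allpairs_dep (iotaDl 2 1 n) filter_map.
rewrite (@eq_filter _ (preim _ _) (fun x => odd x == b)); last first.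
  by move=> x /=; rewrite negbK.
have shift r : sumn [seq size (alternating (~~ b) k (n.+2 - x)) | x <- map (addn 2) r]
    = sumn [seq size (alternating (~~ b) k (n - x)) | x <- r].
  by rewrite -map_comp; congr sumn; apply: eq_map => x /=; rewrite !subSS.
by case: b shift => shift /=; rewrite shift ?subSS ?subn0 ?addn1 ?addn0.
Qed.

(** The boundary values keep Pascal's rule valid everywhere; truncated subtraction in
    ['C(m - 1, k - 1)] would give 1 at [k = 0]. *)
Definition num_compositions (m k : nat) : nat :=
  match m, k with
  | 0, 0 => 1
  | m'.+1, k'.+1 => 'C(m', k')
  | _, _ => 0
  end.

Lemma num_compositionsS m k :
  num_compositions m.+1 k.+1 = num_compositions m k + num_compositions m k.+1.
Proof. by case: m k => [|m] [|k] //=; rewrite ?bin0 // binS addnC. Qed.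

Lemma num_compositions_small m k : m < k -> num_compositions m k = 0.
Proof. by case: m k => [|m] [|k] //= mk; rewrite bin_small. Qed.

Arguments num_compositions : simpl never.

(** Counts the odd parts among [k] parts of alternating parity, the first being odd exactly when [b]
    holds. *)
Definition num_odd (b : bool) (k : nat) : nat := if b then uphalf k else k./2.

Lemma num_oddS b k : num_odd b k.+1 = b + num_odd (~~ b) k.
Proof. by case: b. Qed.

Lemma num_odd_le b k : num_odd b k <= k.
Proof. by case: b => /=; lia. Qed.

Lemma size_alternating b k n :
  size (alternating b k n) =
    if odd (n + num_odd b k) then 0
    else num_compositions (n + num_odd b k)./2 k.
Proof.
elim: k b n => [|k IHk] b n.
  have -> : num_odd b 0 = 0 by case: b.
  rewrite addn0; case: n => [|[|n]] //=; by rewrite if_same.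
have oS := num_oddS b k; have oD := num_odd_le (~~ b) k.
(* The recursion lowers [n] by 2, hence strong induction with base cases 0 and 1. For 0 the right
   side vanishes, as half of at most [k.+1] is less than [k.+1]. *)
elim/ltn_ind: n => -[|[|n]] IHn.
- rewrite size_alternating0 num_compositions_small ?if_same //; lia.
- rewrite size_alternating1 oS; case: b oS oD {IHn} => oS oD.
    rewrite IHk add0n addnA add2n /= negbK.
    by rewrite num_compositionsS (@num_compositions_small _ k.+1) ?addn0 //; lia.
  by rewrite num_compositions_small ?if_same //; lia.
(* Both summands have the same total [n + num_odd b k.+1]: the odd part removed when [b] holds is
   made up for by [n + b]. Pascal's rule then applies. *)
- rewrite size_alternatingSS IHk IHn // -addnA -oS !addSn /= negbK.
  by case: ifP => // _; rewrite num_compositionsS.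
Qed.

Lemma parity_successions_eq0 s :
  (parity_successions s == 0) = sorted parity_differs s.
Proof.
rewrite /parity_successions sum_nat_eq0.
apply/forallP/(sortedP 0) => [H i lti|H i].
  have lti' : i < (size s).-1 by lia.
  by move: (H (Ordinal lti')); rewrite /parity_differs /= !modn2; lia.
have := H i; have := ltn_ord i; rewrite /parity_differs /= !modn2; lia.
Qed.

Lemma sorted_parity_differs x s :
  sorted parity_differs (x :: s) =
    path parity_differs true (x :: s) || path parity_differs false (x :: s).
Proof. by rewrite /= /parity_differs; case: (odd x); rewrite ?orbF. Qed.

Lemma sumn_ge (s : seq nat) x : x \in s -> x <= sumn s.
Proof.
elim: s => //= y s IHs; rewrite inE => /orP[/eqP ->|/IHs]; first exact: leq_addr.
by move=> /leq_trans; apply; apply: leq_addl.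
Qed.

(** The two lists are disjoint by the parity of the first part. With no parts they could share the
    empty composition, hence [k.+1]. *)
Lemma c_alternating n k :
  c n k.+1 0 =
    size (alternating true k.+1 n) + size (alternating false k.+1 n).
Proof.
pose f (t : k.+1.-tuple 'I_n.+1) : seq nat := map val t.
have f_inj : injective f by move=> t u /(inj_map val_inj) /val_inj.
rewrite /c cardE -(size_map f) -size_cat; apply/perm_size/uniq_perm.
- by rewrite (map_inj_uniq f_inj) enum_uniq.
- rewrite cat_uniq !alternating_uniq andTb andbT; apply/hasPn => s.
  rewrite !mem_alternating; case: s => [|x s] //= /and3P[_ _ /andP[x1 _]].
  by rewrite /parity_differs /= in x1 *; apply/and3P => -[_ _ /andP[]]; lia.
move=> s; rewrite mem_cat !mem_alternating -!andb_orr.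
have -> : path parity_differs (~~ true) s || path parity_differs (~~ false) s
    = (s == [::]) || sorted parity_differs s.
  by case: s => [|x s] //; rewrite sorted_parity_differs orbC.
apply/mapP/idP => [[t]|].
  rewrite mem_enum inE parity_successions_eq0 => /andP[ct pt] ->.
  by rewrite /f size_map size_tuple eqxx ct pt orbT.
case/and3P=> /eqP szs cs ps.
have {}ps : sorted parity_differs s by case: s ps {szs cs}.
(* This bound lets [inord] preserve every part. *)
have le_s x : x \in s -> x < n.+1.
  by move=> /sumn_ge; case/andP: cs => _ /eqP ->.
have szt : size (map (@inord n) s) == k.+1 by rewrite size_map szs.
have fE : f (Tuple szt) = s.
  rewrite /f /= -map_comp -[RHS]map_id; apply/eq_in_map => x xs /=.
  by rewrite inordK // le_s.
exists (Tuple szt); last by [].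
by rewrite mem_enum inE -[map val _]/(f (Tuple szt)) fE cs parity_successions_eq0.
Qed.

Theorem proposition6 (n d : nat) (hn : 1 <= n) :
  c n (2 * d) 0 =
    (if n == d %[mod 2]
     then 2 * binz ((n + d) %/ 2 - 1) ((2 * d)%:Z - 1)%R
     else 0)
  /\
  c n (2 * d + 1) 0 =
    (if n == d %[mod 2]
     then binz ((n + d) %/ 2 - 1) (2 * d)%:Z
     else binz ((n + d - 1) %/ 2) (2 * d)%:Z).
Proof.
have half_pos m k : 0 < m -> num_compositions m k.+1 = 'C(m - 1, k).
  by case: m => // m _; rewrite subn1.
have parity : (n == d %[mod 2]) = ~~ odd (n + d) by rewrite !modn2; lia.
split.
  case: d parity => [|d] parity.
    (* For [d = 0] the lower index is -1, so [binz] gives 0, and the empty sequence does not sum to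
       [n]. *)
    rewrite /= if_same; apply: eq_card0 => t; rewrite inE tuple0 /=.
    by rewrite /is_composition /= eq_sym eqn0Ngt hn.
  have -> : ((2 * d.+1)%:Z - 1)%R = (2 * d).+1 by lia.
  have -> : 2 * d.+1 = (2 * d).+2 by lia.
  rewrite c_alternating !size_alternating parity /=.
  have -> : uphalf (2 * d) = d by lia.
  have -> : (2 * d)./2 = d by lia.
  (* Either parity of the first part yields [d.+1] odd parts, hence the factor 2. *)
  case: ifP => //= even; rewrite addnn -mul2n half_pos ?divn2 //; lia.
rewrite addn1 c_alternating !size_alternating parity /=.
have -> : uphalf (2 * d) = d by lia.
have -> : (2 * d)./2 = d by lia.
(* There are [d.+1] odd parts if the first is odd and [d] otherwise, so the parity of [n + d] leaves
   only one list nonzero. *)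
rewrite addnS /=; case: (boolP (odd (n + d))) => par /=.
  by rewrite addn0 half_pos ?divn2; [congr 'C(_, _)|]; lia.
by rewrite add0n half_pos ?divn2; [congr 'C(_, _)|]; lia.
Qed.
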